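(* Let $V$ be a real vector space that decomposes as a direct sum $V=V_1\oplus\dots\oplus V_n$, and let $f:V\to\mathbb{R}\cup\{+\infty\}$ be a positively one-homogeneous convex functional such that $f(v)=0$ only if $v=0$, and $$f(v)=\sum_{i=1}^n f(v_i)\quad\text{whenever } v=\sum_{i=1}^n v_i\ \text{with } v_i\in V_i .$$ Then $$v=\sum_{i=1}^n v_i\in\mathrm{Ext}\big(\{w\in V: f(w)\le 1\}\big)\qquad(v_i\in V_i)$$ if and only if there is an index $i_0\in\{1,\dots,n\}$ as well as $v_{i_0}$ with $$v=v_{i_0}\quad\text{and}\quad v_{i_0}\in\mathrm{Ext}\big(\{w\in V_{i_0}: f(w)\le 1\}\big).$$
   Context: Positively one-homogeneous means $f(\lambda v)=\lambda f(v)$ for all $\lambda>0$, $v\in V$, and $f(0)=0$. $\mathrm{Ext}(C)$ denotes the set of extremal points of a convex set $C$: points $u\in C$ such that $u=\lambda u_1+(1-\lambda)u_2$ with $u_1,u_2\in C$, $\lambda\in[0,1]$ implies $u=u_1$ or $u=u_2$.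
   Formalization: The ''if'' direction is stated only for v ≠ 0 (the ''only if'' direction for all v), because it fails at v = 0: for V = R, V_1 = {0}, V_2 = R, f = |·|, the point 0 is extremal in {0} but not in [-1,1]. *)

(* Defs.v *)
From HB Require Import structures.
From mathcomp Require Import all_boot all_order all_algebra.
From mathcomp Require Import all_classical all_reals.

Set Implicit Arguments.
Unset Strict Implicit.
Unset Printing Implicit Defensive.

Import Order.TTheory GRing.Theory Num.Theory.

Local Open Scope classical_set_scope.
Local Open Scope ring_scope.

Definition extreme_points (R : realType) (V : lmodType R) (C : set V) : set V :=
  [set u | C u /\
     forall (u1 u2 : V) (t : R), C u1 -> C u2 -> 0 <= t <= 1 ->
       u = t *: u1 + (1 - t) *: u2 -> u = u1 \/ u = u2].

(* The internal direct sum V = W_0 (+) ... (+) W_(n-1); V may be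
   infinite-dimensional, so the summands are predicates, not {vspace V}. *)
Definition direct_sum_decomposition (R : realType) (V : lmodType R) (n : nat)
    (W : 'I_n -> submodClosed V) : Prop :=
  forall v : V, exists! w : 'I_n -> V,
    (forall i, w i \in W i) /\ v = \sum_(i < n) w i.

Definition pos_one_homogeneous (R : realType) (V : lmodType R)
    (f : V -> \bar R) : Prop :=
  (forall (l : R) (v : V), 0 < l -> f (l *: v) = (l%:E * f v)%E) /\
  f 0 = 0%E.

(* Meant for f that never takes the value -oo: the right-hand side is then
   never of the form +oo + -oo.  When t is 0 or 1, it is computed with the
   library's convention 0 * +oo = 0, and the inequality is trivially true. *)
Definition econvex (R : realType) (V : lmodType R) (f : V -> \bar R) : Prop :=
  forall (u v : V) (t : R), 0 <= t <= 1 ->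
    (f (t *: u + (1 - t) *: v)%R <= t%:E * f u + (1 - t)%R%:E * f v)%E.

(* Main.v *)
From HB Require Import structures.
Require Import Defs.
From mathcomp Require Import all_boot all_order all_algebra.
From mathcomp Require Import all_classical all_reals.
From mathcomp Require Import lra.
Import Order.TTheory GRing.Theory Num.Theory.
Local Open Scope classical_set_scope.
Local Open Scope ring_scope.

(** Write [P] for the projection onto one summand and split a vector as
    [x = P x + (x - P x)]; all that matters of the direct sum is that
    [f x = f (P x) + f (x - P x)].

    The functional may take negative values, so two facts replace positivity.

    - If [a <> 0] lies in the summand, [b <> 0] in its complement, and both
      values are finite, then [f a] and [f b] have the same sign: otherwise
      [|f b| a + |f a| b] would be a nonzero zero of [f] ([split_same_sign]).

    - A nonzero extreme point has [f v = 1]: otherwise it lies strictly between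
      [0] and a larger multiple of itself that is still in the sublevel set
      ([extreme_value1]).

    If [v] is extreme and both parts [a = P v] and [b = v - P v] are nonzero,
    then [f a + f b = 1] with equal signs, so both values are positive and [v]
    is the convex combination, with weights [f a] and [f b], of the normalized
    parts; neither of them is [v] ([extreme_no_split]).

    Conversely let [v <> 0] be extreme within the summand and
    [v = t u1 + (1 - t) u2] with [0 < t < 1] and [u1], [u2] in the sublevel
    set.  The complementary parts [b1], [b2] satisfy [t b1 + (1 - t) b2 = 0].
    If they vanish, [u1] and [u2] are in the summand and extremality applies
    there.  If not, [f b1] and [f b2] have the sign of [f] on the nonzero one
    of [P u1], [P u2]; convexity at [0] forces that sign to be positive, so the
    complementary parts use up some of the budget [f <= 1], and convexity gives
    [f v < 1], contradicting [f v = 1] ([extreme_of_summand]). *)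

(** * Projections of a direct sum *)

Section Component.
Context {R : realType} {V : lmodType R} {n : nat} {W : 'I_n -> submodClosed V}.
Context (W_direct : direct_sum_decomposition W).

Definition component (i : 'I_n) (v : V) : V := sval (cid (W_direct v)) i.

Lemma component_mem i v : component i v \in W i.
Proof. by rewrite /component; case: cid => w [[]]. Qed.

Lemma component_sum v : v = \sum_(i < n) component i v.
Proof. by rewrite /component; case: cid => w [[]]. Qed.

Lemma component_uniq (w : 'I_n -> V) i :
  (forall j, w j \in W j) -> component i (\sum_(j < n) w j) = w i.
Proof.
move=> wW; rewrite /component; case: cid => w' /= [_ w'_uniq].
by rewrite (w'_uniq w).
Qed.

Lemma component_linear i : linear (component i).
Proof.
move=> a u v.
rewrite {1}(component_sum u) {1}(component_sum v) scaler_sumr -big_split /=.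
rewrite (@component_uniq (fun j => a *: component j u + component j v)) //.
by move=> j; rewrite rpredD ?rpredZ ?component_mem.
Qed.

HB.instance Definition _ i :=
  GRing.isLinear.Build R V V *:%R (component i) (component_linear i).

Lemma component_id i v : v \in W i -> component i v = v.
Proof.
move=> vW; pose w j := if j == i then v else 0.
have {1}-> : v = \sum_(j < n) w j by rewrite -big_mkcond big_pred1_eq.
rewrite component_uniq /w ?eqxx // => j.
by case: eqP => [->|_] //; rewrite rpred0.
Qed.

Lemma component_split (f : V -> \bar R) i v :
  f 0 = 0%E ->
  (forall w : 'I_n -> V, (forall i, w i \in W i) ->
     f (\sum_(i < n) w i) = (\sum_(i < n) f (w i))%E) ->
  f v = (f (component i v) + f (v - component i v)%R)%E.
Proof.
move=> f0 f_split; pose w j := if j == i then 0 else component j v.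
have -> : v - component i v = \sum_(j < n) w j.
  rewrite {1}(component_sum v) (bigD1 i) //= addrAC subrr add0r.
  rewrite [RHS](bigD1 i) //= /w eqxx add0r.
  by apply: eq_bigr => j /negPf ->.
rewrite {1}(component_sum v) !f_split => [|j|j]; last exact: component_mem.
  rewrite (bigD1 i) //=; congr (_ + _)%E.
  rewrite [RHS](bigD1 i) //= /w eqxx f0 add0e.
  by apply: eq_bigr => j /negPf ->.
by rewrite /w; case: ifP; rewrite ?rpred0 ?component_mem.
Qed.

End Component.

(** * Functionals that are additive along a projection *)

Section SplitFunctional.
Context {R : realType} {V : lmodType R} {f : V -> \bar R}.
Context (f_gtNy : forall v : V, f v <> -oo%E).
Context (f_hom : pos_one_homogeneous f).
Context (f_definite : forall v : V, f v = 0%E -> v = 0).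

Lemma fin_of_le1 u : (f u <= 1)%E -> {r : R | f u = r%:E & r <= 1}.
Proof. by have := f_gtNy u; case: (f u) => // r _; exists r. Qed.

Lemma hom_fin c u r : 0 < c -> f u = r%:E -> f (c *: u) = (c * r)%:E.
Proof. by move=> c0 fu; rewrite f_hom.1 // fu EFinM. Qed.

(** The two hypotheses on [C] say that it is the part of the sublevel set of
    [f] inside some cone, which covers both the whole space and a summand. *)
Lemma extreme_value1 (C : set V) v :
  (forall u, C u -> (f u <= 1)%E) ->
  (forall (c : R) u, C u -> 0 <= c -> (f (c *: u) <= 1)%E -> C (c *: u)) ->
  extreme_points C v -> v <> 0 -> f v = 1%E.
Proof.
move=> C_le1 C_scale [Cv v_ext] v0.
have [r fv r1] := fin_of_le1 _ (C_le1 _ Cv).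
have C0 : C 0.
  by rewrite -(scale0r v); apply: C_scale; rewrite ?scale0r ?f_hom.2 ?lee01.
(* [v] is the convex combination of [0] and [c *: v] with weight [c^-1]. *)
have key c : 1 < c -> c * r <= 1 -> False.
  move=> c1 cr; have c0 : 0 < c by lra.
  have Ccv : C (c *: v).
    apply: C_scale => //; first exact: ltW.
    by rewrite (hom_fin c v r) // lee_fin.
  case: (v_ext _ 0 c^-1 Ccv C0) => //.
  - by rewrite invr_ge0 ltW //= invf_le1 // ltW.
  - by rewrite scaler0 addr0 scalerA mulVf ?scale1r // gt_eqF.
  move/eqP; rewrite eq_sym -subr_eq0 -{2}(scale1r v) -scalerBl scaler_eq0.
  by case/orP=> /eqP //; lra.
(* Any [c > 1] will do if [f v <= 0]; if [0 < f v < 1], take [c = 1 / f v]. *)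
have [r0|r0] := leP r 0; first by case: (key 2); lra.
move: r1; rewrite le_eqVlt => /orP[/eqP <- //|r1].
by case: (key r^-1); rewrite ?invf_gt1 // mulVf // gt_eqF.
Qed.

Context {P : {linear V -> V}}.
Context (P_idem : forall u, P (P u) = P u).
Context (f_split : forall u, f u = (f (P u) + f (u - P u)%R)%E).

Lemma proj_compl u : P (u - P u) = 0.
Proof. by rewrite linearB /= P_idem subrr. Qed.

Lemma fin_parts u : (f u <= 1)%E ->
  exists r s : R, [/\ f (P u) = r%:E, f (u - P u) = s%:E,
                      f u = (r + s)%:E & r + s <= 1].
Proof.
rewrite f_split.
move: (f_gtNy (P u)) (f_gtNy (u - P u)).
by case: (f (P u)) => [r||] //; case: (f (u - P u)) => [s||] // _ _; exists r, s.
Qed.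

(** Parts with values of opposite signs could be rescaled so that the values
    cancel, giving a nonzero zero of [f]. *)
Lemma split_same_sign a b r s : P a = a -> P b = 0 -> a <> 0 -> b <> 0 ->
  f a = r%:E -> f b = s%:E -> 0 < r * s.
Proof.
have neq0 u q : u <> 0 -> f u = q%:E -> q != 0.
  by move=> u0 fu; apply/eqP => q0; apply/u0/f_definite; rewrite fu q0.
move=> Pa Pb a0 b0 fa fb.
have r0 := neq0 _ _ a0 fa; have s0 := neq0 _ _ b0 fb.
rewrite ltNge le_eqVlt mulf_eq0 (negPf r0) (negPf s0) /=; apply/negP => rs0.
pose x := `|s| *: a + `|r| *: b.
have Px : P x = `|s| *: a by rewrite linearD !linearZ /= Pa Pb scaler0 addr0.
have fx : f x = (`|s| * r + `|r| * s)%:E.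
  rewrite f_split Px addrAC subrr add0r.
  by rewrite (hom_fin _ a r) ?normr_gt0 // (hom_fin _ b s) ?normr_gt0.
have x0 : x = 0.
  apply: f_definite; rewrite fx; congr EFin.
  have [sr|sr] := leP 0 r; have [ss|ss] := leP 0 s;
    rewrite ?(ger0_norm sr) ?(ltr0_norm sr) ?(ger0_norm ss) ?(ltr0_norm ss); nra.
move: Px; rewrite x0 linear0 => /esym/eqP.
by rewrite scaler_eq0 normr_eq0 (negPf s0) => /eqP.
Qed.

(** An extreme point has only one nonzero part: two such parts would exhibit it
    as a convex combination of their normalizations. *)
Lemma extreme_no_split v :
  extreme_points [set w : V | (f w <= 1)%E] v -> P v = 0 \/ P v = v.
Proof.
move=> v_extreme; have [v_le1 v_ext] := v_extreme.
have [->|Pv0] := eqVneq (P v) 0; first by left.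
have [/eqP|b0] := eqVneq (v - P v) 0; first by rewrite subr_eq0 => /eqP <-; right.
have v0 : v <> 0 by move=> v0; rewrite v0 linear0 eqxx in Pv0.
have fv : f v = 1%E by apply: extreme_value1 v_extreme v0.
have [r [s [fa fb]]] := fin_parts _ v_le1.
rewrite fv => -[rs _].
have rs0 : 0 < r * s.
  by apply: (split_same_sign (P v) (v - P v)); rewrite ?proj_compl //; apply/eqP.
have r0 : 0 < r by nra.
have s0 : 0 < s by nra.
have part_le1 u q : 0 < q -> f u = q%:E -> (f (q^-1 *: u) <= 1)%E.
  by move=> q0 fu; rewrite (hom_fin _ u q) ?invr_gt0 // mulVf ?gt_eqF.
case: (v_ext (r^-1 *: P v) (s^-1 *: (v - P v)) r) => [||||va|vb].
- exact: part_le1.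
- exact: part_le1.
- lra.
- have -> : 1 - r = s by lra.
  by rewrite !scalerA !mulfV ?gt_eqF // !scale1r addrC subrK.
- by right; rewrite va linearZ /= P_idem.
- by left; rewrite vb linearZ /= proj_compl scaler0.
Qed.

Context (f_convex : econvex f).

(** Complementary parts of [u1] and [u2] would cost a positive amount of the
    bound [f <= 1], leaving too little for [f v = 1]; without them, extremality
    in the summand applies. *)
Lemma extreme_of_summand v : P v = v -> v <> 0 ->
  extreme_points [set w : V | P w = w /\ (f w <= 1)%E] v ->
  extreme_points [set w : V | (f w <= 1)%E] v.
Proof.
move=> Pv v0 v_extreme; have [[_ v_le1] v_ext] := v_extreme.
have fv : f v = 1%E.
  apply: extreme_value1 v_extreme v0 => [u []//|c u [Pu _] _ ?].
  by split; rewrite // linearZ /= Pu.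
split=> // u1 u2 t u1_le1 u2_le1 /andP[t_ge0 t_le1] vE.
have [t0|t0] := eqVneq t 0.
  by right; rewrite vE t0 scale0r add0r subr0 scale1r.
have [t1|t1] := eqVneq t 1; first by left; rewrite vE t1 subrr scale0r addr0 scale1r.
have t_gt0 : 0 < t by rewrite lt0r t0.
have t_lt1 : 0 < 1 - t by rewrite subr_gt0 lt_neqAle t1.
have [r1 [s1 [fa1 fb1 _ le1]]] := fin_parts _ u1_le1.
have [r2 [s2 [fa2 fb2 _ le2]]] := fin_parts _ u2_le1.
set b1 := u1 - P u1 in fb1; set b2 := u2 - P u2 in fb2.
have vPE : v = t *: P u1 + (1 - t) *: P u2 by rewrite -Pv vE linearD !linearZ.
have bE : 0 = t *: b1 + (1 - t) *: b2.
  by rewrite !scalerBr addrACA -opprD -vE -vPE subrr.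
have t01 : 0 <= t <= 1 by rewrite t_ge0.
have fb_ge0 : 0 <= t * s1 + (1 - t) * s2.
  by have := f_convex b1 b2 t t01; rewrite -bE f_hom.2 fb1 fb2.
have fa_ge1 : 1 <= t * r1 + (1 - t) * r2.
  by have := f_convex (P u1) (P u2) t t01; rewrite -vPE fv fa1 fa2.
have [b10|b10] := eqVneq b1 0.
  have b20 : b2 = 0.
    move: bE; rewrite b10 scaler0 add0r => /esym/eqP.
    by rewrite scaler_eq0 gt_eqF // => /eqP.
  move: b10 b20 => /eqP; rewrite subr_eq0 => /eqP Pu1 /eqP.
  rewrite subr_eq0 => /eqP Pu2.
  exact: (v_ext u1 u2 t).
have b20 : b2 <> 0.
  move=> b20; move: bE; rewrite b20 scaler0 addr0 => /esym/eqP.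
  by rewrite scaler_eq0 gt_eqF // (negPf b10).
move/eqP in b10.
have Pb1 : P b1 = 0 by exact: proj_compl.
have Pb2 : P b2 = 0 by exact: proj_compl.
have signs u q : P u <> 0 -> f (P u) = q%:E -> 0 < q * s1 /\ 0 < q * s2.
  move=> Pu0 fPu; split.
    exact: (split_same_sign (P u) b1).
  exact: (split_same_sign (P u) b2).
(* [q] is the value at a nonzero part [P u1] or [P u2]; it serves only to
   compare the signs of [s1] and [s2]. *)
have [q [q1 q2]] : exists q, 0 < q * s1 /\ 0 < q * s2.
  have [a10|/eqP a10] := eqVneq (P u1) 0; last by exists r1; apply: signs fa1.
  have [a20|/eqP a20] := eqVneq (P u2) 0; last by exists r2; apply: signs fa2.
  by case: v0; rewrite vPE a10 a20 !scaler0 addr0.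
(* A common negative sign would contradict [fb_ge0]. *)
have s1_gt0 : 0 < s1.
  rewrite ltNge; apply/negP => s1_le0.
  have q_lt0 : q < 0 by nra.
  have s2_lt0 : s2 < 0 by nra.
  have ts2 : (1 - t) * s2 < 0 by nra.
  have ts1 : t * s1 <= 0 by nra.
  suff : (0 : R) < 0 by rewrite ltxx.
  lra.
have q_gt0 : 0 < q by nra.
have s2_gt0 : 0 < s2 by nra.
have tr1 : t * r1 < t * 1 by rewrite ltr_pM2l //; lra.
have tr2 : (1 - t) * r2 < (1 - t) * 1 by rewrite ltr_pM2l //; lra.
suff : (1 : R) < 1 by rewrite ltxx.
lra.
Qed.

End SplitFunctional.

(** * Extreme points of the sublevel set *)

Theorem lemma4p1 (R : realType) (V : lmodType R) (n : nat) (n_gt0 : (0 < n)%N)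
    (W : 'I_n -> submodClosed V) (W_direct : direct_sum_decomposition W)
    (f : V -> \bar R) (f_gtNy : forall v : V, f v <> -oo%E)
    (f_hom : pos_one_homogeneous f) (f_convex : econvex f)
    (f_definite : forall v : V, f v = 0%E -> v = 0)
    (f_split : forall w : 'I_n -> V, (forall i, w i \in W i) ->
       f (\sum_(i < n) w i) = (\sum_(i < n) f (w i))%E)
    (v : V) (v_ : 'I_n -> V) (v_W : forall i, v_ i \in W i)
    (v_sum : v = \sum_(i < n) v_ i) :
  (extreme_points [set w : V | (f w <= 1)%E] v ->
     exists i0 : 'I_n, v = v_ i0 /\
       extreme_points [set w : V | w \in W i0 /\ (f w <= 1)%E] (v_ i0)) /\
  (v <> 0 ->
     (exists i0 : 'I_n, v = v_ i0 /\
        extreme_points [set w : V | w \in W i0 /\ (f w <= 1)%E] (v_ i0)) ->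
     extreme_points [set w : V | (f w <= 1)%E] v).
Proof.
have P_idem i u : component W_direct i (component W_direct i u)
                  = component W_direct i u.
  by rewrite component_id ?component_mem.
have P_split i u := component_split W_direct f i u f_hom.2 f_split.
have v_E i : component W_direct i v = v_ i by rewrite v_sum component_uniq.
split=> [v_extreme|v0 [i [vE v_extreme]]].
  have [i vE] : exists i, v = v_ i.
    (* The origin has all its components equal to it, so any index will do. *)
    have [v0|/eqP v0] := eqVneq v 0.
      by exists (Ordinal n_gt0); rewrite -v_E v0 linear0.
    have [i vi0] : exists i, v_ i <> 0.
      apply: contrapT => /forallNP vi0; apply: v0; rewrite v_sum big1 // => i _.
      exact: contrapT (vi0 i).
    exists i; rewrite -v_E.
    have [] // := extreme_no_split f_gtNy f_hom f_definite (P_idem i) (P_split i)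
      v v_extreme.
    by rewrite /= v_E.
  exists i; split=> //; rewrite -vE; have [v_le1 v_ext] := v_extreme.
  split; first by rewrite /= {1}vE.
  by move=> u1 u2 t [_ ?] [_ ?]; apply: v_ext.
apply: (extreme_of_summand f_gtNy f_hom f_definite (P_idem i) (P_split i)
  f_convex _ _ v0); first by rewrite /= v_E -vE.
have -> : [set w | component W_direct i w = w /\ (f w <= 1)%E]
          = [set w | w \in W i /\ (f w <= 1)%E].
  apply/seteqP; split=> w /= [wW ?]; split=> //; last exact: component_id.
  by rewrite -wW component_mem.
by rewrite vE.
Qed.
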